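(* Let $H$ be a connected bipartite graph with no vertices of degree zero or one, and let $G=G(H)$ be the extension of $H$. Then \[\mu(W(H);z)=h^*(\mathcal{F}_1(G);z).\]
   Context: A bipartite graph $H$ with shores $S(H)$ and $T(H)$ is regarded as a directed acyclic graph with every edge directed from $S(H)$ to $T(H)$ (so the sources are the vertices of $S(H)$ and the sinks the vertices of $T(H)$). The extension $G(H)$ is the directed multigraph obtained from $H$ by adding new vertices $s,t$, two parallel directed edges from $s$ to each $i\in S(H)$, and two parallel directed edges from each $j\in T(H)$ to $t$. For a directed acyclic multigraph $G$, $\mathcal{F}_1(G)\subseteq\mathbb{R}^{E(G)}$ is the set of $f:E(G)\to\mathbb{R}_{\ge0}$ satisfying flow conservation (inflow equals outflow) at every vertex having both incoming and outgoing edges, and with total flow out of the source vertices equal to $1$; it is a lattice polytope. For a lattice polytope $P\subseteq\mathbb{R}^N$ of dimension $d$, the Ehrhart $h^*$-polynomial $h^*(P;z)$ is the polynomial defined by $\sum_{t\ge0}|tP\cap\mathbb{Z}^N|z^t=h^*(P;z)/(1-z)^{d+1}$. The almost-degree-whiskered graph $W(H)$ is obtained from $H$ by attaching to each vertex $v$ exactly $\deg_H(v)-1$ new pendant vertices adjacent only to $v$. For a graph $W$ on $n$ vertices, the unsigned matching polynomial is $\mu(W;z)=\sum_{k=0}^{\lfloor n/2\rfloor}m_kz^k$, where $m_k$ is the number of matchings of $W$ with exactly $k$ edges ($m_0=1$). *)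

(* Defs.v *)
From HB Require Import structures.
From mathcomp Require Import all_boot all_order all_algebra.
From mathcomp Require Import boolp classical_sets functions cardinality reals.

Set Implicit Arguments.
Unset Strict Implicit.
Unset Printing Implicit Defensive.

Import Order.TTheory GRing.Theory Num.Theory.

(** * Finite simple graphs *)

Record sgraph := SGraph {
  svertex :> finType;
  sadj : rel svertex;
  sadj_sym : symmetric sadj;
  sadj_irr : irreflexive sadj }.

Definition sdeg (W : sgraph) (v : W) : nat := #|[pred w | sadj v w]|.

(* The graph without vertices is not connected. *)
Definition sconnected (W : sgraph) : Prop :=
  (0 < #|W|)%N /\ forall x y : W, connect (@sadj W) x y.

Definition sedges (W : sgraph) : {set {set W}} :=
  [set A : {set W} | [exists x, exists y, sadj x y && (A == [set x; y]%SET)]]%SET.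

Definition is_matching (W : sgraph) (M : {set {set W}}) : bool :=
  (M \subset sedges W) && finset.trivIset M.

Definition nb_matchings (W : sgraph) (k : nat) : nat :=
  #|[set M : {set {set W}} | is_matching M && (#|M| == k)]%SET|.

Definition matching_poly (W : sgraph) : {poly int} :=
  (\poly_(k < (#|W|./2).+1) (nb_matchings W k)%:R)%R.

(** * The almost-degree-whiskered graph *)

Section Whisker.
Variable H : sgraph.

(* [inl v] is the vertex [v] of [H]; [inr (Tagged _ i)] with tag [v] is the
   [i]-th pendant vertex attached to [v]. *)
Definition wh_vertex : finType := (H + {v : H & 'I_(sdeg v - 1)})%type.

Definition wh_adj (x y : wh_vertex) : bool :=
  match x, y with
  | inl u, inl v => sadj u v
  | inl u, inr p => tag p == u
  | inr p, inl v => tag p == v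
  | inr _, inr _ => false
  end.

Lemma wh_adj_sym : symmetric wh_adj.
Proof. by case=> [u|p] [v|q] //=; apply: sadj_sym. Qed.

Lemma wh_adj_irr : irreflexive wh_adj.
Proof. by case=> [u|p] //=; apply: sadj_irr. Qed.

Definition whisker : sgraph := SGraph wh_adj_sym wh_adj_irr.

End Whisker.

(** * Bipartite graphs and their extensions *)

Record bigraph := BiGraph {
  bg_graph :> sgraph;
  shoreS : {set bg_graph};
  shoreT : {set bg_graph};
  shores_partition : shoreT = (~: shoreS)%SET;
  shores_edge : forall x y : bg_graph, sadj x y ->
    (x \in shoreS) && (y \in shoreT) || (x \in shoreT) && (y \in shoreS) }.

Record dmgraph := DMGraph {
  dvertex : finType;
  dedge : finType;
  dsrc : dedge -> dvertex;
  dtgt : dedge -> dvertex }.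

Section Extension.
Variable H : bigraph.

(* [inr false] is the new vertex s and [inr true] the new vertex t. *)
Definition ext_vertex : finType := (H + bool)%type.
Definition ext_s : ext_vertex := inr false.
Definition ext_t : ext_vertex := inr true.

(* The edges of [H], each as the pair (end in S, end in T), then two copies
   (indexed by [bool]) of s -> i for i in S and of j -> t for j in T. *)
Definition ext_edge : finType :=
  ({p : H * H | [&& p.1 \in shoreS H, p.2 \in shoreT H & sadj p.1 p.2]}
   + ({i : H | i \in shoreS H} * bool + {j : H | j \in shoreT H} * bool))%type.

Definition ext_src (e : ext_edge) : ext_vertex :=
  match e with
  | inl p => inl (val p).1
  | inr (inl _) => ext_s
  | inr (inr (j, _)) => inl (val j)
  end.

Definition ext_tgt (e : ext_edge) : ext_vertex :=
  match e with
  | inl p => inl (val p).2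
  | inr (inl (i, _)) => inl (val i)
  | inr (inr _) => ext_t
  end.

Definition extension : dmgraph := DMGraph ext_src ext_tgt.

End Extension.

Local Open Scope classical_set_scope.
Local Open Scope ring_scope.

(** * Flow polytopes *)

Definition has_in (G : dmgraph) (v : dvertex G) : bool :=
  [exists e : dedge G, dtgt e == v].

Definition has_out (G : dmgraph) (v : dvertex G) : bool :=
  [exists e : dedge G, dsrc e == v].

(* [R^o] is [R] seen as a vector space over itself, so that the space of
   functions on edges is a finite dimensional vector space over [R]. *)
Definition flow_polytope1 (R : realType) (G : dmgraph) :
    set {ffun dedge G -> R^o} :=
  [set f : {ffun dedge G -> R^o} |
           [/\ forall e, 0 <= f e :> R,
               forall v, has_in v -> has_out v ->
                 \sum_(e | dtgt e == v) f e = \sum_(e | dsrc e == v) f e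
             & \sum_(e | ~~ has_in (dsrc e)) f e = 1]].

Arguments flow_polytope1 R G : clear implicits.

(** * Ehrhart theory *)

Section Ehrhart.
Variables (R : realType) (N : finType).
Implicit Types (P : set {ffun N -> R^o}) (h : {poly int}).

(* [U] is the direction of the affine hull of [P]. *)
Definition aff_direction P (U : {vspace {ffun N -> R^o}}) : Prop :=
  (forall x y, P x -> P y -> x - y \in U) /\
  (forall W : {vspace {ffun N -> R^o}},
     (forall x y, P x -> P y -> x - y \in W) -> (U <= W)%VS).

Definition has_dim P (d : nat) : Prop :=
  P !=set0 /\ exists2 U, aff_direction P U & \dim U = d.

Definition dilate_lattice P (t : nat) : set {ffun N -> R^o} :=
  [set x | (exists2 p, P p & x = t%:R *: p) /\
           forall i, (x i : R) \is a Num.int].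

(* The identity of formal power series
   [\sum_t L t z^t = h / (1 - z)^(d + 1)], multiplied by [(1 - z)^(d + 1)] and
   read coefficientwise, where [L t] is the (finite) number of lattice points
   of the [t]-th dilate of [P]. *)
Definition is_hstar P h : Prop :=
  exists (d : nat) (L : nat -> nat),
    [/\ has_dim P d,
        forall t, (dilate_lattice P t #= `I_(L t))%card
      & forall n, \sum_(i < n.+1) ((1 - 'X) ^+ d.+1 : {poly int})`_i
                    * (L (n - i)%N)%:R = h`_n].

(* The value is 0 if no such polynomial exists; 0 is never the h*-polynomial
   of a nonempty [P], as its constant coefficient is [L 0 = 1]. *)
Definition hstar P : {poly int} := xget 0 [set h | is_hstar P h].

Lemma has_dim_uniq P d d' : has_dim P d -> has_dim P d' -> d = d'.
Proof.
move=> [_ [U [U1 U2] <-]] [_ [W [W1 W2] <-]].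
by apply/eqP; rewrite eqn_leq !dimvS // ?U2 ?W2.
Qed.

Lemma is_hstar_uniq P h h' : is_hstar P h -> is_hstar P h' -> h = h'.
Proof.
move=> [d [L [dP LP hP]]] [d' [L' [dP' LP' hP']]].
have dd := has_dim_uniq dP dP'; subst d'.
apply/polyP => n; rewrite -hP -hP'; apply: eq_bigr => i _; congr (_ * _%:R).
by apply/card_eq_II; apply: card_eq_trans (LP' _); rewrite card_eq_sym.
Qed.

Lemma hstarE P h : is_hstar P h -> hstar P = h.
Proof. by move=> hP; apply: xget_unique => // h' /is_hstar_uniq; apply. Qed.

End Ehrhart.

(* Main.v *)
Require Import Defs.
From HB Require Import structures.
From mathcomp Require Import all_boot all_order all_algebra.
From mathcomp Require Import reals.
From mathcomp Require Import ring.

(** An integer flow of value [t] on [G(H)] is an [f : E(H) -> nat] of total [t]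
    together with, at each vertex [v], a splitting of the weight
    [deg_f v = \sum_(e at v) f e] over the two parallel edges at [v]; hence
    [L t = \sum_f \prod_v (1 + deg_f v)], and the polytope has dimension
    [|E| + |V| - 1].  Expanding the product, each vertex chooses either nothing
    or an incident edge, and an edge chosen [k <= 2] times contributes
    [\sum_m m^k z^m], that is [1], [z], [z + z^2] over [(1 - z)^(k + 1)].
    Splitting [z + z^2] into [z^2] (two independent choices) and [z] (a matched
    edge) yields [\sum_M z^|M| \prod_(v not in M) (1 - z + deg v * z)] over
    [(1 - z)^(|E| + |V|)], with [M] ranging over the matchings of [H]; the factor
    [1 + (deg v - 1) z] is exactly the choice of an optional whisker at [v]. *)

Set Implicit Arguments.
Unset Strict Implicit.
Unset Printing Implicit Defensive.

Import Order.TTheory GRing.Theory Num.Theory.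
Local Open Scope ring_scope.

(** * Auxiliary identities for sums and products *)

Lemma big_option (R : Type) (idx : R) (op : Monoid.com_law idx) (T : finType)
    (F : option T -> R) :
  \big[op/idx]_(c : option T) F c = op (F None) (\big[op/idx]_(x : T) F (Some x)).
Proof.
rewrite (bigD1 None) //=; congr (op _ _).
rewrite (reindex_omap Some id) //=; last by case.
by apply: eq_bigl => x; rewrite eqxx.
Qed.

Lemma prodr_fiber (R : comNzRingType) (V C : finType) (phi : V -> C) (G : C -> R) :
  \prod_v G (phi v) = \prod_c G c ^+ #|[pred v | phi v == c]|.
Proof.
rewrite (partition_big phi xpredT) //=; apply: eq_bigr => c _.
by rewrite -prodr_const; apply: eq_bigr => v /eqP ->.
Qed.

Lemma prodr_bool (R : comNzRingType) (I : finType) (b : pred I) :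
  \prod_i (b i)%:R = [forall i, b i]%:R :> R.
Proof.
case: forallP => [h|/forallP /forallPn [i /negbTE bi]].
  by rewrite big1 // => i _; rewrite h.
by rewrite (bigD1 i) //= bi mul0r.
Qed.

(** * Power series truncated modulo ['X^N] *)

Section EqCoef.
Variable N : nat.
Implicit Types p q : {poly int}.

(** Congruence modulo ['X^N], so that power series identities can be handled with polynomials. *)
Definition eqcoef p q := forall i, (i < N)%N -> p`_i = q`_i.

Lemma eqcoef_trans p q r : eqcoef p q -> eqcoef q r -> eqcoef p r.
Proof. by move=> h k i ltiN; rewrite h ?k. Qed.

Lemma eqcoefD p q p' q' : eqcoef p q -> eqcoef p' q' -> eqcoef (p + p') (q + q').
Proof. by move=> h k i ltiN; rewrite !coefD h ?k. Qed.

Lemma eqcoefM p q p' q' : eqcoef p q -> eqcoef p' q' -> eqcoef (p * p') (q * q').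
Proof.
move=> h k i ltiN; rewrite !coefM; apply: eq_bigr => j _; rewrite h ?k //.
  exact: leq_ltn_trans (leq_subr _ _) ltiN.
exact: leq_ltn_trans (leq_ord j) ltiN.
Qed.

Lemma eqcoef_sum (I : finType) (F G : I -> {poly int}) :
  (forall i, eqcoef (F i) (G i)) -> eqcoef (\sum_i F i) (\sum_i G i).
Proof. by move=> h; apply: (big_ind2 eqcoef) => //; apply: eqcoefD. Qed.

Lemma eqcoef_prod (I : finType) (F G : I -> {poly int}) :
  (forall i, eqcoef (F i) (G i)) -> eqcoef (\prod_i F i) (\prod_i G i).
Proof. by move=> h; apply: (big_ind2 eqcoef) => //; apply: eqcoefM. Qed.

(** Multiplying a series by [1 - 'X] takes backward differences of its coefficients; the only
    discrepancy caused by the truncation sits in degree [N], which [eqcoef] ignores. *)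
Lemma eqcoef_diff (g : nat -> int) :
  eqcoef ((1 - 'X) * \poly_(m < N) g m)
         (\poly_(m < N) (g m - (if m is m'.+1 then g m' else 0))).
Proof.
move=> i ltiN; rewrite mulrBl mul1r coefB coefXM !coef_poly ltiN.
by case: i ltiN => [|i] ltiN //=; rewrite ltnW.
Qed.

(* The numerators of [\sum_m m ^ k X^m] over [(1 - X)^(k + 1)] for k <= 2. *)
Lemma eqcoef_pow_series k : (k <= 2)%N ->
  eqcoef ((1 - 'X) ^+ k.+1 * \poly_(m < N) (m%:R ^+ k))
         ('X^k + (k == 2%N)%:R * 'X).
Proof.
have step (g : nat -> int) j : eqcoef ((1 - 'X) ^+ j.+1 * \poly_(m < N) g m)
    ((1 - 'X) ^+ j * \poly_(m < N) (g m - (if m is m'.+1 then g m' else 0))).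
  by rewrite exprSr -mulrA; apply: eqcoefM => //; apply: eqcoef_diff.
case: k => [|[|[|//]]] _.
- apply: eqcoef_trans (step _ _) _ => i ltiN.
  rewrite expr0 mul1r coef_poly ltiN mul0r addr0 expr0 coef1.
  by case: i ltiN => // i _; rewrite !expr0 subrr.
- apply: eqcoef_trans (step _ _) _; apply: eqcoef_trans (step _ _) _ => i ltiN.
  rewrite expr0 mul1r coef_poly ltiN mul0r addr0 expr1 coefX.
  by case: i ltiN => [|[|i]] _ //; rewrite !expr1 /=; ring.
- do 3 apply: eqcoef_trans (step _ _) _; move=> i ltiN.
  rewrite expr0 mul1r coef_poly ltiN eqxx mul1r coefD coefXn coefX.
  by case: i ltiN => [|[|[|i]]] _ //=; ring.
Qed.

End EqCoef.

(** * The generating function of weighted edge functions and its numerator *)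

Section Incidence.
Variables (V E : finType) (inc : E -> V -> bool).

Definition weight N (f : {ffun E -> 'I_N}) v := (\sum_(e | inc e v) f e)%N.

(** The bound [N] makes the type of [f] finite; for [t < N] it excludes no function of total [t]. *)
Definition weighted_count N t :=
  (\sum_(f : {ffun E -> 'I_N} | (\sum_e f e)%N == t) \prod_v (1 + weight f v))%N.

Definition covered (M : {set E}) v := [exists e in M, inc e v].

Definition inc_matching (M : {set E}) :=
  [forall e in M, forall e' in M, forall v, inc e v && inc e' v ==> (e == e')].

Definition cover_poly : {poly int} :=
  \sum_(M : {set E} | inc_matching M)
    'X^#|M| * \prod_(v | ~~ covered M v) (1 + 'X *+ (#|[pred e | inc e v]| - 1)).

Hypothesis inc_card : forall e, #|[pred v | inc e v]| = 2%N.
Hypothesis deg_gt0 : forall v, (0 < #|[pred e | inc e v]|)%N.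

Definition valid v (c : option E) : bool := if c is Some e then inc e v else true.

Definition choice_card (phi : {ffun V -> option E}) c := #|[pred v | phi v == c]|.

Lemma choice_card_le (phi : {ffun V -> option E}) e :
  [forall v, valid v (phi v)] -> (choice_card phi (Some e) <= 2)%N.
Proof.
move=> /forallP val_phi; rewrite -(inc_card e); apply/subset_leq_card/subsetP => v.
by rewrite !inE => /eqP phiv; have := val_phi v; rewrite phiv.
Qed.

(** Only the two ends of [e] may choose it, so two choices of [e] exhaust its ends. *)
Lemma choice_card2 (phi : {ffun V -> option E}) e :
  [forall v, valid v (phi v)] ->
  (choice_card phi (Some e) == 2%N) = [forall (v | inc e v), phi v == Some e].
Proof.
move=> /forallP val_phi.
have sub : [pred v | phi v == Some e] \subset [pred v | inc e v].
  by apply/subsetP => v; rewrite !inE => /eqP phiv; have := val_phi v; rewrite phiv.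
rewrite -(inc_card e) (subset_leqif_card sub).
apply/subsetP/forallP => h v; last by rewrite inE => ev; have := h v; rewrite ev.
by apply/implyP => ?; apply: h.
Qed.

Definition weight_gf N : {poly int} :=
  \sum_(f : {ffun E -> 'I_N}) ((\prod_v (1 + weight f v))%N)%:R * 'X^(\sum_e f e)%N.

Lemma coef_weight_gf N t : (weight_gf N)`_t = (weighted_count N t)%:R.
Proof.
rewrite /weight_gf coef_sum /weighted_count natr_sum.
rewrite [RHS]big_mkcond; apply: eq_bigr => f _; rewrite eq_sym.
by rewrite mulr_natl coefMn coefXn; case: eqP; rewrite ?mul0rn.
Qed.

Lemma prodr_choice (R : comNzRingType) (phi : {ffun V -> option E}) (x : R) (G : E -> R) :
  \prod_v (if phi v is Some e then G e else x) =
  x ^+ choice_card phi None * \prod_e G e ^+ choice_card phi (Some e).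
Proof. by rewrite (prodr_fiber phi (fun c => if c is Some e then G e else x)) big_option. Qed.

(** Distributing the product over the vertices yields one choice [phi v] per vertex. For a fixed
    [phi] the summand is a product over the edges, [f e] being raised to the number of times [e] is
    chosen, so the sum over [f] factors into one truncated series per edge. *)
Lemma weight_gf_choice N :
  weight_gf N = \sum_(phi : {ffun V -> option E} | [forall v, valid v (phi v)])
    \prod_e \poly_(m < N) (m%:R ^+ choice_card phi (Some e)).
Proof.
pose w (f : {ffun E -> 'I_N}) v (c : option E) : {poly int} :=
  (valid v c)%:R * (if c is Some e then (f e)%:R else 1).
have wE f : (\prod_v (1 + weight f v))%N%:R =
    \sum_(phi : {ffun V -> option E}) \prod_v w f v (phi v).
  rewrite -bigA_distr_bigA natr_prod; apply: eq_bigr => v _.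
  rewrite big_option /w mul1r natrD natr_sum /=; congr (_ + _).
  by rewrite big_mkcond; apply: eq_bigr => e _; case: inc; rewrite ?mul1r ?mul0r.
rewrite /weight_gf; under eq_bigr do rewrite wE mulr_suml.
rewrite exchange_big [RHS]big_mkcond /=; apply: eq_bigr => phi _.
under eq_bigr do rewrite big_split /= prodr_bool.
case: ifP => [val_phi|nval]; last first.
  by rewrite big1 // => f _; rewrite !mul0r.
under [in RHS]eq_bigr do rewrite poly_def.
rewrite bigA_distr_bigA; apply: eq_bigr => f _.
rewrite mul1r prodr_choice expr1n mul1r -prodrXr -big_split /=.
by apply: eq_bigr => e _; rewrite -mul_polyC rmorphXn rmorph_nat.
Qed.

(* The factor contributed by the choice of [c] at [v] once the edges of [M] are
   required to be chosen by both of their ends. *)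
Definition choice_weight (M : {set E}) v (c : option E) : {poly int} :=
  (valid v c && [forall e in M, inc e v ==> (c == Some e)])%:R *
  (if c is Some e then (if e \in M then 1 else 'X) else 1 - 'X).

(** If an edge of [M] meets [v], that edge is the only choice that can survive, with weight 1, and
    it survives when no other edge of [M] meets [v]. Otherwise the choice [None] gives [1 - 'X] and
    each edge at [v] gives ['X]. *)
Lemma sum_choice_weight (M : {set E}) v :
  \sum_c choice_weight M v c =
  if covered M v
  then [forall e in M, forall e' in M, inc e v && inc e' v ==> (e == e')]%:R
  else 1 + 'X *+ (#|[pred e | inc e v]| - 1).
Proof.
case: ifPn => [/exists_inP [e eM ev]|ncov].
  rewrite (bigD1 (Some e)) //= big1 => [|c /negbTE ce].
    rewrite /choice_weight /= ev eM mulr1 addr0; congr (_ : bool)%:R.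
    apply/forall_inP/forall_inP => [h e1 e1M|h e1 e1M].
      apply/forall_inP => e2 e2M; apply/implyP => /andP [e1v e2v].
      by have := h _ e1M; have := h _ e2M; rewrite e1v e2v => /eqP [<-] /eqP [<-].
    by apply/implyP => e1v; have /forall_inP /(_ _ e1M) := h _ eM; rewrite ev e1v => /eqP ->.
  rewrite /choice_weight; case: forallP => [/(_ e)|]; last by rewrite andbF mul0r.
  by rewrite eM ev ce.
have P c : [forall e in M, inc e v ==> (c == Some e)].
  apply/forall_inP => e eM; apply/implyP => ev; case/exists_inP: ncov; by exists e.
rewrite big_option /choice_weight P /= mul1r.
have -> : \sum_e ((inc e v && [forall e0 in M, inc e0 v ==> (Some e == Some e0)])%:R *
     (if e \in M then 1 else 'X)) = 'X *+ #|[pred e | inc e v]| :> {poly int}.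
  rewrite -sumr_const [RHS]big_mkcond; apply: eq_bigr => e _; rewrite P andbT inE.
  case: (boolP (inc e v)) => [ev|_]; last by rewrite mul0r.
  rewrite mul1r ifN //; apply: contra ncov => eM; apply/exists_inP; by exists e.
(* A positive degree is what keeps the natural subtraction in [deg - 1] from truncating. *)
by rewrite -{1}(prednK (deg_gt0 v)) subn1 mulrS addrA subrK.
Qed.

(** Two distinct edges of [M] meeting at [v] make conflicting demands there, so the factor at [v]
    vanishes and only matchings contribute. *)
Lemma prod_sum_choice_weight (M : {set E}) :
  \prod_v \sum_c choice_weight M v c =
  if inc_matching M
  then \prod_(v | ~~ covered M v) (1 + 'X *+ (#|[pred e | inc e v]| - 1))
  else 0.
Proof.
under eq_bigr do rewrite sum_choice_weight.
case: ifPn => [/forall_inP Mm|].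
  rewrite [RHS]big_mkcond; apply: eq_bigr => v _; rewrite if_neg; case: ifP => // _.
  suff -> : [forall e in M, forall e' in M, inc e v && inc e' v ==> (e == e')] by [].
  apply/forall_inP => e eM; apply/forall_inP => e' e'M.
  by have /forall_inP /(_ _ e'M) /forallP := Mm _ eM; apply.
case/forall_inPn => e eM /forall_inPn [e' e'M] /forallPn [v].
rewrite negb_imply => /andP [/andP [ev e'v] ne].
rewrite (bigD1 v) //= ifT; last by apply/exists_inP; exists e.
case: forall_inP => [/(_ _ eM) /forall_inP /(_ _ e'M)|_]; last by rewrite mul0r.
by rewrite ev e'v (negbTE ne).
Qed.

(** [M] records the edges for which the summand ['X] of the numerator ['X^2 + 'X] is taken. Such an
    edge gets its ['X] from ['X^#|M|] and 1 from each end, while any other edge gets one ['X] from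
    each vertex choosing it. *)
Lemma choice_term (M : {set E}) (phi : {ffun V -> option E}) :
  [forall v, valid v (phi v)] ->
  (1 - 'X) ^+ choice_card phi None *
    \prod_e (if e \in M then (choice_card phi (Some e) == 2%N)%:R * 'X
             else 'X^(choice_card phi (Some e))) =
  'X^#|M| * \prod_v choice_weight M v (phi v) :> {poly int}.
Proof.
move=> val_phi.
have -> : \prod_v choice_weight M v (phi v) =
    [forall e in M, choice_card phi (Some e) == 2%N]%:R *
    \prod_v (if phi v is Some e then (if e \in M then 1 else 'X) else 1 - 'X).
  rewrite big_split prodr_bool; congr ((_ : bool)%:R * _).
  apply/forallP/forall_inP => [h e eM|h v].
    rewrite choice_card2 //; apply/forall_inP => v ev.
    by have /andP [_ /forall_inP /(_ _ eM)] := h v; rewrite ev.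
  rewrite (forallP val_phi); apply/forall_inP => e eM; apply/implyP => ev.
  by have := h _ eM; rewrite choice_card2 // => /forall_inP; apply.
rewrite prodr_choice [RHS]mulrA [RHS]mulrCA; congr (_ * _).
have -> : 'X^#|M| = \prod_e (if e \in M then 'X else 1) :> {poly int}.
  by rewrite -big_mkcond prodr_const.
rewrite -prodr_bool -!big_split /=.
apply: eq_bigr => e _; case: ifP => eM /=; last by rewrite !mul1r.
by rewrite expr1n mulr1 mulrC.
Qed.

Theorem weight_gf_cover_poly N :
  eqcoef N ((1 - 'X) ^+ (#|E| + #|V|) * weight_gf N) cover_poly.
Proof.
have -> : cover_poly = \sum_(phi : {ffun V -> option E} | [forall v, valid v (phi v)])
    (1 - 'X) ^+ choice_card phi None *
    \prod_e ('X^(choice_card phi (Some e)) + (choice_card phi (Some e) == 2%N)%:R * 'X).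
  rewrite /cover_poly big_mkcond /=.
  transitivity (\sum_(M : {set E}) 'X^#|M| * \prod_v \sum_c choice_weight M v c).
    by apply: eq_bigr => M _; rewrite prod_sum_choice_weight; case: ifP; rewrite ?mulr0.
  transitivity (\sum_(M : {set E}) \sum_(phi : {ffun V -> option E})
      'X^#|M| * \prod_v choice_weight M v (phi v)).
    by apply: eq_bigr => M _; rewrite bigA_distr_bigA mulr_sumr.
  rewrite exchange_big [RHS]big_mkcond; apply: eq_bigr => phi _.
  case: ifP => [val_phi|/forallP nval].
    (* The summands are swapped so that the set [M] indexing the expansion consists of the edges
       taking ['X]. *)
    under [in RHS]eq_bigr do rewrite addrC.
    rewrite bigA_distr mulr_sumr; apply: eq_bigr => M _.
    by rewrite -choice_term.
  rewrite big1 // => M _; rewrite big_split prodr_bool /=.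
  by case: forallP => [h|_]; [case: nval => v; case/andP: (h v)|rewrite mul0r mulr0].
rewrite weight_gf_choice mulr_sumr big_mkcond [X in eqcoef _ _ X]big_mkcond /=.
apply: eqcoef_sum => phi; case: ifP => // val_phi.
(* Each vertex makes exactly one choice, so the [#|V|] factors are shared out between [None] and the
   edges; the other [#|E|] factors supply the extra one in the denominator of each edge series. *)
have -> : (1 - 'X : {poly int}) ^+ (#|E| + #|V|) = (1 - 'X) ^+ choice_card phi None *
    \prod_e (1 - 'X) ^+ (choice_card phi (Some e)).+1.
  under eq_bigr do rewrite exprS; rewrite big_split mulrCA -prodr_choice exprD.
  rewrite -!prodr_const; congr (_ * _).
  by apply: eq_bigr => v _; case: (phi v).
rewrite -mulrA -big_split; apply: eqcoefM => //; apply: eqcoef_prod => e.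
exact/eqcoef_pow_series/choice_card_le.
Qed.

End Incidence.

(** * Counting edge functions together with splittings of their vertex weights *)

Lemma sum_pair_bool (R : nmodType) (I : finType) (i : I) (F : I * bool -> R) :
  \sum_(p | p.1 == i) F p = F (i, true) + F (i, false).
Proof.
transitivity (\sum_(j | j == i) \sum_b F (j, b)); last by rewrite big_pred1_eq big_bool.
by rewrite pair_big; apply: eq_big => [[j b]|[j b]] //=; rewrite andbT.
Qed.

Lemma sum_ord_le N m : (m < N)%N -> (\sum_(k < N | (k <= m)%N) 1 = m.+1)%N.
Proof.
by move=> ltmN; rewrite -(big_ord_widen N (fun=> 1%N) ltmN) sum1_card card_ord.
Qed.

Section PointCount.
Variables (V E : finType) (inc : E -> V -> bool).

(** [j.1] is the flow on the edges and [j.2 v] the part of the weight of [v] carried by one of its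
    two parallel edges. *)
Definition weighted_points N t : {set {ffun E -> 'I_N} * {ffun V -> 'I_N}} :=
  [set j : {ffun E -> 'I_N} * {ffun V -> 'I_N} | ((\sum_e j.1 e)%N == t) &&
           (j.2 \in family (fun v => [pred k : 'I_N | (k <= weight inc j.1 v)%N]))].

Lemma weight_le N (f : {ffun E -> 'I_N}) v : (weight inc f v <= \sum_e f e)%N.
Proof. by rewrite /weight [leqRHS](bigID (inc^~ v)) /= leq_addr. Qed.

Lemma card_weighted_points N t : (t < N)%N ->
  #|weighted_points N t| = weighted_count inc N t.
Proof.
move=> lttN; rewrite -sum1_card.
under eq_bigl do rewrite inE.
rewrite -(pair_big_dep (fun f : {ffun E -> 'I_N} => (\sum_e f e)%N == t)
  (fun f => [in family (fun v => [pred k : 'I_N | (k <= weight inc f v)%N])])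
  (fun _ _ => 1%N)) /=.
apply: eq_bigr => f /eqP ft.
transitivity (\prod_v \sum_(k < N | (k <= weight inc f v)%N) 1)%N.
  rewrite bigA_distr_big_dep; apply: eq_bigr => a _; by rewrite big1.
(* The weight at [v] is at most [t < N], so all its [weight + 1] splittings fit in ['I_N]. *)
apply: eq_bigr => v _; rewrite sum_ord_le // (leq_ltn_trans _ lttN) // -ft.
exact: weight_le.
Qed.

End PointCount.

(** * Matchings and the matching polynomial *)

Lemma trivIset_eq (T : finType) (M : {set {set T}}) (A B : {set T}) x :
  trivIset M -> A \in M -> B \in M -> x \in A -> x \in B -> A = B.
Proof.
move=> /trivIsetP tM AM BM xA xB; apply/eqP; apply/contraT => /(tM _ _ AM BM).
by move=> /disjointFr /(_ xA); rewrite xB.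
Qed.

Section MatchingPoly.
Variable W : sgraph.

Lemma sedges_card (A : {set W}) : A \in sedges W -> #|A| = 2%N.
Proof.
rewrite inE => /existsP [x /existsP [y /andP [xy /eqP ->]]]; rewrite cards2.
by case: eqP xy => // ->; rewrite sadj_irr.
Qed.

(** Disjoint edges cover [2 * #|M|] vertices. Hence the degree bound in [matching_poly] loses no
    matching. *)
Lemma matching_card (M : {set {set W}}) : is_matching M -> (#|M| <= #|W|./2)%N.
Proof.
case/andP => /subsetP sM /eqP tM; rewrite geq_half_double.
suff -> : (#|M|.*2 = #|cover M|)%N by apply: max_card.
rewrite -tM (eq_bigr (fun=> 2%N)) => [|A /sM /sedges_card //].
by rewrite sum_nat_const muln2.
Qed.

Lemma matching_polyE :
  matching_poly W = \sum_(M : {set {set W}} | is_matching M) 'X^#|M|.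
Proof.
apply/polyP => k; rewrite coef_poly coef_sum.
have -> : \sum_(M : {set {set W}} | is_matching M) ('X^#|M| : {poly int})`_k =
    (nb_matchings W k)%:R.
    rewrite /nb_matchings -sum1_card natr_sum big_mkcond [RHS]big_mkcond /=.
  apply: eq_bigr => M _; rewrite inE coefXn eq_sym.
  by case: is_matching => //=; case: eqP.
case: ltnP => // ltk; rewrite /nb_matchings (_ : [set _ | _] = set0) ?cards0 //.
apply/setP => M; rewrite !inE; apply/negP => /andP [/matching_card Mm /eqP Mk].
by rewrite Mk leqNgt ltk in Mm.
Qed.

End MatchingPoly.

(** * Matchings of the whiskered graph *)

Section Whisker.
Variable H : bigraph.

(** Storing an edge as its pair (end in S, end in T) lists each undirected edge once and agrees with
    the inner edges of [ext_edge]. *)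
Definition bedge : finType :=
  {p : H * H | [&& p.1 \in shoreS H, p.2 \in shoreT H & sadj p.1 p.2]}.

Definition binc (e : bedge) (v : H) := ((val e).1 == v) || ((val e).2 == v).

Lemma bedge_neq (e : bedge) : (val e).1 != (val e).2.
Proof. by case: e => -[x y] /= /and3P [_ _]; apply: contraTneq => ->; rewrite sadj_irr. Qed.

Lemma binc_card e : #|[pred v | binc e v]| = 2%N.
Proof.
have := card2 (val e).1 (val e).2; rewrite bedge_neq => <-; apply: eq_card => v.
by rewrite !inE /binc ![_ == v]eq_sym.
Qed.

Lemma shoreTE (v : H) : (v \in shoreT H) = (v \notin shoreS H).
Proof. by rewrite shores_partition inE. Qed.

Lemma sadj_bedge (x y : H) : sadj x y ->
  (exists e : bedge, val e = (x, y)) \/ (exists e : bedge, val e = (y, x)).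
Proof.
move=> xy; case/orP: (shores_edge xy) => /andP [xS yT].
  have h : [&& (x, y).1 \in shoreS H, (x, y).2 \in shoreT H & sadj (x, y).1 (x, y).2]
    by rewrite /= xS yT.
  by left; exists (Sub (x, y) h).
have h : [&& (y, x).1 \in shoreS H, (y, x).2 \in shoreT H & sadj (y, x).1 (y, x).2]
  by rewrite /= xS yT sadj_sym.
by right; exists (Sub (y, x) h).
Qed.

Definition opposite (v : H) (e : bedge) : H := if (val e).1 == v then (val e).2 else (val e).1.

(** Sending an edge at [v] to its other end is a bijection onto the neighbours of [v]; it is
    injective because the shores determine the order of the two ends. *)
Lemma binc_degree v : #|[pred e | binc e v]| = sdeg v.
Proof.
rewrite -(card_in_imset (f := opposite v)) => [|e e'].
  apply: eq_card => w; rewrite inE; apply/imsetP/idP => [[e]|].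
    rewrite inE /binc /opposite; case: e => -[x y] /= /and3P [_ _ xy].
    by case: eqP => [<- _ -> //|_ /= /eqP <- ->]; rewrite sadj_sym.
  move=> vw; have nvw : v != w by apply: contraTneq vw => ->; rewrite sadj_irr.
  case: (sadj_bedge vw) => -[e ee]; exists e; rewrite ?inE /binc /opposite ee /= ?eqxx ?orbT //.
  by rewrite eq_sym (negbTE nvw).
rewrite !inE /binc /opposite => ev e'v eq_op; apply: val_inj.
case: e e' ev e'v eq_op => -[x y] /= /and3P [xS yT xy] [[x' y'] /= /and3P [x'S y'T x'y']].
case: (eqVneq x v) => [->|_ /= /eqP ->]; case: (eqVneq x' v) => [->|_] /=.
- by move=> _ _ ->.
- by move=> _ _ y_x'; move: yT; rewrite y_x' shoreTE x'S.
- by move=> _ xy'; move: y'T; rewrite -xy' shoreTE xS.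
- by move=> /eqP -> ->.
Qed.

Local Notation P := {v : H & 'I_(sdeg v - 1)}.
Local Notation W := (whisker H).

Definition hedge (e : bedge) : {set W} := [set inl (val e).1; inl (val e).2].
Definition pedge (p : P) : {set W} := [set inl (tag p); inr p].

Lemma in_hedge e x : (x \in hedge e) = (if x is inl v then binc e v else false).
Proof. by case: x => v; rewrite !inE //= /binc ![_ == v]eq_sym. Qed.

Lemma in_pedge p x : (x \in pedge p) = match x with inl v => tag p == v | inr q => p == q end.
Proof. by case: x => v; rewrite !inE /= ?orbF eq_sym. Qed.

Lemma hedge_inj : injective hedge.
Proof.
move=> e e' /setP eq_ee; apply: val_inj.
have h v : binc e v = binc e' v by have := eq_ee (inl v); rewrite !in_hedge.
move: (h (val e).1) (h (val e).2) (valP e) (valP e'); rewrite /binc.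
case: (val e) (val e') => [x y] [x' y'] /=; rewrite !eqxx orbT /=.
move=> + + /and3P [xS yT _] /and3P [x'S y'T _].
have -> : (x' == y) = false by apply: contraTF yT => /eqP <-; rewrite shoreTE x'S.
have -> : (y' == x) = false by apply: contraTF y'T => /eqP ->; rewrite shoreTE xS.
by rewrite orbF => /esym /eqP -> /esym /eqP ->.
Qed.

Lemma pedge_inj : injective pedge.
Proof.
by move=> p q /setP /(_ (inr q)); rewrite !in_pedge eqxx => /eqP.
Qed.

Lemma hedge_pedge e p : hedge e != pedge p.
Proof. by apply/eqP => /setP /(_ (inr p)); rewrite in_hedge in_pedge eqxx. Qed.

Lemma whisker_edgeP (A : {set W}) :
  reflect ((exists e, A = hedge e) \/ (exists p, A = pedge p)) (A \in sedges W).
Proof.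
rewrite inE; apply: (iffP existsP) => [[x /existsP [y /andP [xy /eqP ->]]]|].
  case: x y xy => [x|p] [y|q] //=.
  - case/sadj_bedge => -[e ee]; left; exists e; rewrite /hedge ee //=.
    by rewrite setUC.
  - by move=> /eqP <-; right; exists q.
  - by move=> /eqP <-; right; exists p; rewrite setUC.
case=> [[e ->]|[p ->]].
  exists (inl (val e).1); apply/existsP; exists (inl (val e).2); rewrite eqxx andbT.
  by case: e => -[x y] /= /and3P [].
by exists (inl (tag p)); apply/existsP; exists (inr p); rewrite /= !eqxx.
Qed.

(** A matching is described by its edges in [H] and, at each vertex, the whisker used there, if any.
    A value of [j.2] at [v] that is a whisker of another vertex is ignored. *)
Definition encode (j : {set bedge} * {ffun H -> option P}) : {set {set W}} :=
  hedge @: j.1 :|: pedge @: [set p | j.2 (tag p) == Some p].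

Definition decode (M : {set {set W}}) : {set bedge} * {ffun H -> option P} :=
  ([set e | hedge e \in M], [ffun v => [pick p : P | (tag p == v) && (pedge p \in M)]]).

Lemma hedge_encode j e : (hedge e \in encode j) = (e \in j.1).
Proof.
rewrite inE mem_imset; last exact: hedge_inj.
case: imsetP => [[p _ /eqP]|_]; last by rewrite orbF.
by rewrite (negbTE (hedge_pedge _ _)).
Qed.

Lemma pedge_encode j p : (pedge p \in encode j) = (j.2 (tag p) == Some p).
Proof.
rewrite inE [_ \in pedge @: _]mem_imset ?inE; last exact: pedge_inj.
case: imsetP => [[e _ /eqP]|_] //.
by rewrite eq_sym (negbTE (hedge_pedge _ _)).
Qed.

Definition whisker_choice (M : {set bedge}) v (c : option P) : bool :=
  if c is Some p then (tag p == v) && ~~ covered binc M v else true.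

Lemma decode_encode (M : {set bedge}) (q : {ffun H -> option P}) :
  (forall v p, q v = Some p -> tag p = v) -> decode (encode (M, q)) = (M, q).
Proof.
move=> qtag; congr pair; first by apply/setP => e; rewrite inE hedge_encode.
apply/ffunP => v; rewrite ffunE; case: pickP => [p /andP [/eqP <-]|h].
  by rewrite pedge_encode => /eqP.
case qv: (q v) => [p|//]; have := h p; rewrite pedge_encode (qtag _ _ qv) eqxx /= qv eqxx.
by [].
Qed.

Lemma encode_decode (M : {set {set W}}) : is_matching M -> encode (decode M) = M.
Proof.
case/andP => /subsetP sM tM; apply/setP => A; apply/idP/idP => [|AM].
  case/setUP => /imsetP [x]; rewrite inE => xM -> //.
  move: xM; rewrite ffunE; case: pickP => [p /andP [_ pM] /eqP [<-] //|//].
case/whisker_edgeP: (sM _ AM) => -[x xA]; rewrite xA in AM *.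
  by rewrite hedge_encode inE.
(* The whisker picked at a vertex is the given one, since two whisker edges of a matching sharing
   that vertex coincide. *)
rewrite pedge_encode ffunE; case: pickP => [p /andP [/eqP tp pM]|/(_ x)].
  apply/eqP; congr Some; apply: pedge_inj.
  by apply: (trivIset_eq (x := inl (tag x)) tM) => //; rewrite in_pedge ?tp.
by rewrite eqxx AM.
Qed.

(** The left side is the index condition left by reindexing along [encode]. Invariance under
    [decode] forces every whisker of [q] to hang at its own vertex, and disjointness forces that
    vertex to be missed by [M]. *)
Lemma encode_matching (M : {set bedge}) (q : {ffun H -> option P}) :
  is_matching (encode (M, q)) && (decode (encode (M, q)) == (M, q)) =
  inc_matching binc M && (q \in family (whisker_choice M)).
Proof.
apply/andP/andP => [[/andP [_ tM] /eqP [_ dq]]|[Mm /familyP qf]].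
  split.
    apply/forall_inP => e eM; apply/forall_inP => e' e'M; apply/forallP => v.
    apply/implyP => /andP [ev e'v]; apply/eqP/hedge_inj.
    by apply: (trivIset_eq (x := inl v) tM); rewrite ?hedge_encode ?in_hedge.
  apply/familyP => v; rewrite unfold_in /whisker_choice.
  have := congr1 (fun g : {ffun _ -> _} => g v) dq; rewrite ffunE.
  case: pickP => [p /andP [/eqP tp pM] <-|_ <- //]; rewrite tp eqxx /=.
  apply/exists_inP => -[e eM ev]; have /negP := hedge_pedge e p; apply; apply/eqP.
  by apply: (trivIset_eq (x := inl v) tM); rewrite ?hedge_encode ?in_hedge ?in_pedge ?tp.
have qtag v p : q v = Some p -> tag p = v /\ ~~ covered binc M v.
  by move=> qv; have := qf v; rewrite unfold_in qv /= => /andP [/eqP].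
split; last by apply/eqP/decode_encode => v p /qtag [].
apply/andP; split.
  by apply/subsetP => A /setUP [] /imsetP [x _ ->]; apply/whisker_edgeP; [left|right]; exists x.
have hp e p x : e \in M -> q (tag p) = Some p -> x \in hedge e -> x \in pedge p -> False.
  move=> eM /qtag [_ /exists_inP nc]; rewrite in_hedge in_pedge; case: x => // v ev /eqP tp.
  by apply: nc; exists e; rewrite ?tp.
(* Two members with a common vertex are shown equal, according to whether each is an edge of [H] or
   a whisker edge; [hp] rules out the mixed cases. *)
apply/trivIsetP => A B AM BM; apply: contraNT; rewrite -setI_eq0 => /set0Pn [x /setIP []].
case/setUP: AM => /imsetP [a]; case/setUP: BM => /imsetP [b]; rewrite ?inE /=.
- move=> bM -> aM ->; rewrite !in_hedge; case: x => // v av bv.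
  have /forall_inP /(_ _ aM) /forall_inP /(_ _ bM) /forallP /(_ v) := Mm.
  by rewrite av bv => /eqP ->.
- by move=> /eqP qb -> aM -> xa xb; case: (hp _ _ _ aM qb xa xb).
- by move=> bM -> /eqP qa -> xa xb; case: (hp _ _ _ bM qa xb xa).
move=> /eqP qb -> /eqP qa ->; rewrite !in_pedge; case: x => [v|p] /eqP av /eqP bv.
  by move: qa qb; rewrite av bv => -> [->].
by rewrite av bv.
Qed.

(** The whisker edges in use are counted by the vertices they hang at, [tag] being injective on
    them. *)
Lemma card_encode (M : {set bedge}) (q : {ffun H -> option P}) :
  q \in family (whisker_choice M) ->
  #|encode (M, q)| = (#|M| + \sum_v (q v != None : nat))%N.
Proof.
move=> /familyP qf; rewrite cardsU (_ : _ :&: _ = set0) ?cards0 ?subn0; last first.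
  apply/eqP/set0Pn => -[A /setIP [/imsetP [e _ ->] /imsetP [p _ /eqP]]].
  by rewrite (negbTE (hedge_pedge _ _)).
rewrite !card_imset; [|exact: pedge_inj|exact: hedge_inj]; congr addn.
rewrite -(card_in_imset (f := tag)) => [|p p'].
  rewrite -sum1_card big_mkcond; apply: eq_bigr => v _.
  case: imsetP => [[p]|h].
    by rewrite inE /= => /eqP qp ->; rewrite qp.
  case qv: (q v) => [p|//]; case: h; exists p.
    by rewrite inE; have := qf v; rewrite unfold_in qv /= => /andP [/eqP -> _]; rewrite qv.
  by have := qf v; rewrite unfold_in qv /= => /andP [/eqP -> _].
by rewrite !inE /= => /eqP qp /eqP qp' tt; move: qp; rewrite tt qp' => -[].
Qed.

Lemma card_pendant v : #|[pred p : P | tag p == v]| = (sdeg v - 1)%N.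
Proof.
pose pendant (i : 'I_(sdeg v - 1)) : P := Tagged (fun v : H => 'I_(sdeg v - 1)) i.
rewrite -[RHS]card_ord -(card_codom (f := pendant)).
  apply: eq_card => p; rewrite inE; apply/eqP/codomP => [|[i ->] //].
  by case: p => w i /= wv; subst w; exists i.
by move=> i j /eqP; rewrite eq_Tagged => /eqP.
Qed.

(** Once [M] is fixed, whiskers are chosen independently at the vertices: a covered vertex
    contributes 1, an uncovered one contributes 1 for no whisker and ['X] for each of its [deg - 1]
    whiskers. *)
Theorem matching_poly_whisker : matching_poly W = cover_poly binc.
Proof.
rewrite matching_polyE (reindex_onto encode decode) /=; last exact: encode_decode.
rewrite /cover_poly.
transitivity (\sum_(M : {set bedge} | inc_matching binc M)
    \sum_(q in family (whisker_choice M)) 'X^#|M| * \prod_v 'X^(q v != None) : {poly int}).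
  rewrite pair_big_dep; apply: eq_big => [[M q]|[M q]]; first by rewrite encode_matching.
  by rewrite encode_matching => /andP [_ /card_encode ->]; rewrite exprD prodrXr.
apply: eq_bigr => M _; rewrite -mulr_sumr
  -(bigA_distr_big_dep (whisker_choice M) (fun _ c => 'X^(c != None))); congr (_ * _).
rewrite [RHS]big_mkcond; apply: eq_bigr => v _.
rewrite big_mkcond big_option /= expr0 binc_degree; case: (covered binc M v) => /=.
  by rewrite big1 ?addr0 // => p _; rewrite andbF.
rewrite -card_pendant -sumr_const [in RHS]big_mkcond; congr (_ + _).
by apply: eq_bigr => p _; rewrite andbT inE expr1.
Qed.

End Whisker.

(* Flows on the extension *)
From mathcomp Require Import boolp classical_sets functions cardinality.

Section Flow.
Variables (R : realType) (H : bigraph).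
Hypothesis deg_gt0 : forall v : H, (0 < #|[pred e | @binc H e v]|)%N.

Local Notation X := (ext_edge H).
Implicit Types (f : {ffun X -> R^o}) (v : H).

(** A common name for the parallel edges at [v], from s or to t according to the shore, which lets
    both shores be treated alike. *)
Definition pend v (b : bool) : X :=
  match decP (@idP (v \in shoreS H)) with
  | left h => inr (inl (exist _ v h, b))
  | right h => inr (inr (exist _ v (etrans (shoreTE v) (introN idP h)), b))
  end.

Lemma pendS (i : {i : H | i \in shoreS H}) b : pend (val i) b = inr (inl (i, b)).
Proof.
rewrite /pend; case: decP => h; last by case: h; apply: (valP i).
by congr (inr (inl (_, _))); apply: val_inj.
Qed.

Lemma pendT (j : {j : H | j \in shoreT H}) b : pend (val j) b = inr (inr (j, b)).
Proof.
rewrite /pend; case: decP => h; first by have := valP j; rewrite shoreTE h.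
by congr (inr (inr (_, _))); apply: val_inj.
Qed.

Variant ext_edge_spec : X -> Type :=
  | ExtInner e : ext_edge_spec (inl e)
  | ExtPend v b : ext_edge_spec (pend v b).

Lemma ext_edgeP (x : X) : ext_edge_spec x.
Proof.
case: x => [e|[[i b]|[j b]]]; first exact: ExtInner.
  by rewrite -pendS; apply: ExtPend.
by rewrite -pendT; apply: ExtPend.
Qed.

Lemma bedge_endS (e : bedge H) : (val e).1 \in shoreS H.
Proof. by case/and3P: (valP e). Qed.

Lemma bedge_endT (e : bedge H) : (val e).2 \in shoreT H.
Proof. by case/and3P: (valP e). Qed.

Lemma bincS v e : v \in shoreS H -> binc e v = ((val e).1 == v).
Proof.
move=> vS; rewrite /binc orbC; case: eqP => // ev.
by have := bedge_endT e; rewrite ev shoreTE vS.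
Qed.

Lemma bincT v e : v \in shoreT H -> binc e v = ((val e).2 == v).
Proof.
move=> vT; rewrite /binc; case: eqP => // ev.
by move: vT; rewrite -ev shoreTE bedge_endS.
Qed.

(** Inflow and outflow exchange roles between the shores, so conservation takes the same form
    [balanced] on both; pairing them needs only one case split. *)
Lemma ext_in_out_sum f v :
  (\sum_(x : X | ext_tgt x == inl v) f x, \sum_(x : X | ext_src x == inl v) f x) =
  if v \in shoreS H
  then (f (pend v true) + f (pend v false), \sum_(e | binc e v) f (inl e))
  else (\sum_(e | binc e v) f (inl e), f (pend v true) + f (pend v false)).
Proof.
rewrite !big_sumType /=; case: ifPn => vS.
  rewrite big_pred0 => [|e]; last first.
    by apply/negP => /eqP [ev]; have := bedge_endT e; rewrite ev shoreTE vS.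
  rewrite [X in _ + (_ + X)]big_pred0 // [X in (_, _ + (X + _))]big_pred0 //.
  rewrite [X in (_, _ + (_ + X))]big_pred0 => [|[j b]]; last first.
    by apply/negP => /eqP [ev]; have := valP j; rewrite /= ev shoreTE vS.
  rewrite !(add0r, addr0); congr pair; last by apply: eq_bigl => e; rewrite bincS.
  pose i : {i : H | i \in shoreS H} := exist _ v vS.
  rewrite (pendS i true : pend v true = _) (pendS i false : pend v false = _)
    -(sum_pair_bool i (fun p => f (inr (inl p)))).
  by apply: eq_bigl => -[k b].
have vT : v \in shoreT H by rewrite shoreTE.
rewrite [X in (_ + (X + _), _)]big_pred0 => [|[i b]]; last first.
  by apply/negP => /eqP [ev]; move: vS; rewrite -ev (valP i).
rewrite [X in (_ + (_ + X), _)]big_pred0 // [X in (_, X + _)]big_pred0 => [|e]; last first.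
  by apply/negP => /eqP [ev]; move: vS; rewrite -ev bedge_endS.
rewrite [X in (_, _ + (X + _))]big_pred0 //.
rewrite !(add0r, addr0); congr pair; first by apply: eq_bigl => e; rewrite bincT.
pose j : {j : H | j \in shoreT H} := exist _ v vT.
rewrite (pendT j true : pend v true = _) (pendT j false : pend v false = _)
    -(sum_pair_bool j (fun p => f (inr (inr p)))).
by apply: eq_bigl => -[k b].
Qed.

Definition balanced f :=
  forall v, f (pend v true) + f (pend v false) = \sum_(e | binc e v) f (inl e).

(** The value is measured on the edges of [H], which every path from s to t crosses exactly once. *)
Definition flow_of (t : R) f :=
  [/\ forall x, 0 <= f x :> R, balanced f & \sum_e f (inl e) = t].

Lemma has_binc v : exists e : bedge H, binc e v.
Proof. by have /card_gt0P [e] := deg_gt0 v; exists e. Qed.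

Lemma ext_has_in v : has_in (G := extension H) (inl v).
Proof.
apply/existsP; case: (boolP (v \in shoreS H)) => vS.
  by exists (inr (inl (exist _ v vS, true))).
by have [e] := has_binc v; rewrite bincT ?shoreTE // => /eqP <-; exists (inl e).
Qed.

Lemma ext_has_out v : has_out (G := extension H) (inl v).
Proof.
apply/existsP; case: (boolP (v \in shoreS H)) => vS; last first.
  by exists (inr (inr (exist _ v (etrans (shoreTE v) vS), true))).
by have [e] := has_binc v; rewrite bincS // => /eqP <-; exists (inl e).
Qed.

(** Among the tails of edges only s has no incoming edge. By balance its outflow is the flow on the
    edges of [H] grouped by their end in S. *)
Lemma ext_source_flow f : balanced f ->
  \sum_(x : X | ~~ has_in (G := extension H) (ext_src x)) f x = \sum_e f (inl e).
Proof.
move=> bal; rewrite !big_sumType /= big_pred0 => [|e]; last by rewrite ext_has_in.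
rewrite [X in _ + (_ + X)]big_pred0 => [|[j b]]; last by rewrite ext_has_in.
rewrite add0r addr0 (eq_bigl xpredT) => [|p]; last first.
  by apply/existsP => -[[e|[[i b]|y]] /eqP].
transitivity (\sum_(i : {i : H | i \in shoreS H}) \sum_b f (inr (inl (i, b)))).
  by rewrite pair_bigA; apply: eq_bigr => -[].
transitivity (\sum_(i : {i : H | i \in shoreS H}) \sum_(e | binc e (val i)) f (inl e)).
  by apply: eq_bigr => i _; rewrite big_bool -bal !pendS.
pose end1 (e : bedge H) : {i : H | i \in shoreS H} := Sub (val e).1 (bedge_endS e).
rewrite [RHS](partition_big end1 xpredT) //=; apply: eq_bigr => i _.
apply: eq_bigl => e; rewrite bincS ?(valP i) //.
Qed.

Lemma flow_polytope1E f : flow_polytope1 R (extension H) f <-> flow_of 1 f.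
Proof.
split=> [[f0 fc f1]|[f0 bal f1]].
  have bal : balanced f.
    move=> v; have := fc (inl v) (ext_has_in v) (ext_has_out v).
    by have := ext_in_out_sum f v; case: ifP => _ [-> ->].
  by split=> //; rewrite -ext_source_flow.
split=> //; last by rewrite -[RHS]f1 -ext_source_flow.
case=> [v _ _|[]]; first by have := ext_in_out_sum f v; case: ifP => _ [-> ->]; rewrite bal.
  by move=> _ /existsP [[e|[y|[j b]]]].
by move=> /existsP [[e|[[i b]|y]]].
Qed.

Lemma flow_ofZ (t c : R) f : 0 <= c -> flow_of t f -> flow_of (c * t) (c *: f).
Proof.
move=> c0 [f0 bal ft]; split=> [x|v|].
- by rewrite ffunE mulr_ge0.
- rewrite !ffunE -scalerDr bal scaler_sumr; apply: eq_bigr => e _; by rewrite ffunE.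
- by rewrite -ft mulr_sumr; apply: eq_bigr => e _; rewrite ffunE.
Qed.

(** A parallel edge at [v] carries at most the weight of [v], which is part of the total. This bound
    encloses the lattice points of a dilate in a finite type. *)
Lemma flow_of_le t f x : flow_of t f -> (f x : R) <= t.
Proof.
move=> [f0 bal <-]; case: (ext_edgeP x) => [e|v b].
  by rewrite (bigD1 e) //= lerDl sumr_ge0.
apply: (@le_trans _ _ (\sum_(e | binc e v) f (inl e))).
  by rewrite -bal; case: b; rewrite ?lerDl ?lerDr.
by rewrite [leRHS](bigID (@binc H ^~ v)) /= lerDl sumr_ge0.
Qed.

(** * Linear parametrisation of the balanced flows *)

Local Notation Par := {ffun bedge H + H -> R^o}.
Implicit Types g : Par.

Definition par_weight g v : R := \sum_(e | binc e v) g (inl e).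

(** Balance leaves free the flow on the edges of [H] and that on the copy [true] at each vertex; the
    copy [false] carries the remainder. Integer parameters thus correspond to integer flows. *)
Definition par_flow g : {ffun X -> R^o} := [ffun x : X =>
  match x with
  | inl e => g (inl e)
  | inr (inl (i, b)) => if b then g (inr (val i)) else par_weight g (val i) - g (inr (val i))
  | inr (inr (j, b)) => if b then g (inr (val j)) else par_weight g (val j) - g (inr (val j))
  end].

Lemma par_flow_inner g e : par_flow g (inl e) = g (inl e).
Proof. by rewrite ffunE. Qed.

Lemma par_flow_pend g v b :
  par_flow g (pend v b) = if b then g (inr v) else par_weight g v - g (inr v).
Proof. by rewrite ffunE /pend; case: decP. Qed.

Definition par_total g : R^o := \sum_e g (inl e).

Lemma par_flow_balanced g : balanced (par_flow g).
Proof.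
move=> v; rewrite !par_flow_pend addrC subrK; apply: eq_bigr => e _.
by rewrite par_flow_inner.
Qed.

Lemma par_flow_of g : (forall e, 0 <= g (inl e) :> R) ->
  (forall v, 0 <= g (inr v) <= par_weight g v) -> flow_of (par_total g) (par_flow g).
Proof.
move=> ge gv; split; first 1 last.
- exact: par_flow_balanced.
- by apply: eq_bigr => e _; rewrite par_flow_inner.
move=> x; case: (ext_edgeP x) => [e|v b]; first by rewrite par_flow_inner.
by rewrite par_flow_pend; case/andP: (gv v); case: b; rewrite ?subr_ge0.
Qed.

Definition flow_par f : Par :=
  [ffun k => match k with inl e => f (inl e) | inr v => f (pend v true) end].

Lemma flow_parK f : balanced f -> par_flow (flow_par f) = f.
Proof.
move=> bal; apply/ffunP => x; case: (ext_edgeP x) => [e|v b].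
  by rewrite par_flow_inner ffunE.
rewrite par_flow_pend ffunE /=; case: b => //; apply/eqP; rewrite subr_eq addrC bal.
by apply/eqP/eq_bigr => e _; rewrite ffunE.
Qed.

Lemma par_flow_inj : injective par_flow.
Proof.
move=> g g' /ffunP gg; apply/ffunP => -[e|v].
  by rewrite -!par_flow_inner gg.
by have := gg (pend v true); rewrite !par_flow_pend.
Qed.

Lemma par_flow_linear : linear par_flow.
Proof.
move=> a g g'; apply/ffunP => x; rewrite !ffunE.
have wE v : par_weight (a *: g + g') v = a * par_weight g v + par_weight g' v.
  by rewrite mulr_sumr -big_split; apply: eq_bigr => e _; rewrite !ffunE.
case: x => [e|[[i []]|[j []]]]; rewrite ?wE ?ffunE //= /GRing.scale /=; ring.
Qed.
HB.instance Definition _ :=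
  GRing.isLinear.Build R Par {ffun X -> R^o} _ par_flow par_flow_linear.

Lemma par_total_linear : linear par_total.
Proof.
move=> a g g'; rewrite /par_total scaler_sumr -big_split.
by apply: eq_bigr => e _; rewrite !ffunE.
Qed.
HB.instance Definition _ :=
  GRing.isLinear.Build R Par R^o _ par_total par_total_linear.

(** * Dimension of the flow polytope *)

Definition par_delta (k : bedge H + H) : Par := [ffun l => (l == k)%:R].

Lemma par_delta_decomp g :
  g = \sum_e g (inl e) *: par_delta (inl e) + \sum_v g (inr v) *: par_delta (inr v).
Proof.
rewrite -(big_sumType _ xpredT (fun k => g k *: par_delta k)).
apply/ffunP => l; rewrite sum_ffunE (bigD1 l) //= !ffunE eqxx big1 => [|k kl].
  by rewrite addr0 [_ *: _]mulr1.
by rewrite !ffunE eq_sym (negbTE kl) scaler0.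
Qed.

Lemma par_total_edge e : par_total (par_delta (inl e)) = 1.
Proof.
rewrite /par_total (bigD1 e) //= ffunE eqxx big1 ?addr0 // => e' ne.
by rewrite ffunE -[inl e' == _]/(e' == e) (negbTE ne).
Qed.

Lemma par_total_vertex v : par_total (par_delta (inr v)) = 0.
Proof. by rewrite /par_total big1 // => e _; rewrite ffunE. Qed.

Lemma par_weight_edge e v : par_weight (par_delta (inl e)) v = (binc e v)%:R.
Proof.
rewrite /par_weight big_mkcond (bigD1 e) //= ffunE eqxx big1 ?addr0 => [|e' ne].
  by case: binc.
by rewrite ffunE -[inl e' == _]/(e' == e) (negbTE ne); case: binc.
Qed.

(** This is the unit flow along the path through [e] that uses the copy [false] at both ends. *)
Lemma edge_flow e : flow_polytope1 R (extension H) (par_flow (par_delta (inl e))).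
Proof.
apply/flow_polytope1E; rewrite -(par_total_edge e); apply: par_flow_of => [e'|v].
  by rewrite ffunE ler0n.
by rewrite par_weight_edge ffunE lexx ler0n.
Qed.

(** The same path rerouted through the copy [true] at [v]; its difference with [edge_flow] isolates
    the parameter of [v]. *)
Lemma edge_vertex_flow e v : binc e v ->
  flow_polytope1 R (extension H) (par_flow (par_delta (inl e) + par_delta (inr v))).
Proof.
move=> ev; apply/flow_polytope1E.
have -> : (1 : R) = par_total (par_delta (inl e) + par_delta (inr v)).
  by rewrite linearD /= par_total_edge par_total_vertex addr0.
have wE w : par_weight (par_delta (inl e) + par_delta (inr v)) w = (binc e w)%:R.
  by rewrite -par_weight_edge; apply: eq_bigr => e' _; rewrite !ffunE addr0.
apply: par_flow_of => [e'|w]; first by rewrite !ffunE addr0 ler0n.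
rewrite wE !ffunE add0r ler0n; case: eqP => [[->]|_] /=; first by rewrite ev.
by rewrite ler0n.
Qed.

(** Differences of points of the polytope have total 0. Conversely, differences of the path flows
    above span the image of all parameters of total 0. *)
Lemma flow_direction :
  aff_direction (flow_polytope1 R (extension H))
    (linfun par_flow @: lker (linfun par_total))%VS.
Proof.
split=> [x y /flow_polytope1E [_ xb x1] /flow_polytope1E [_ yb y1]|W hW].
  rewrite -(flow_parK xb) -(flow_parK yb) -linearB /= -[par_flow _]lfunE memv_img //.
  rewrite memv_ker lfunE /= linearB /= /par_total subr_eq0.
  under eq_bigr do rewrite ffunE.
  by under [eqbRHS]eq_bigr do rewrite ffunE; rewrite x1 y1.
apply/subvP => _ /memv_imgP [g + ->]; rewrite memv_ker !lfunE /= => /eqP g0.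
have dv v : par_flow (par_delta (inr v)) \in W.
  have [e ev] := has_binc v; have := hW _ _ (edge_vertex_flow ev) (edge_flow e).
  by rewrite -linearB /= addrC addKr.
have de e e' : par_flow (par_delta (inl e)) - par_flow (par_delta (inl e')) \in W.
  by apply: hW; apply: edge_flow.
rewrite (par_delta_decomp g) linearD !linear_sum /= memvD //; last first.
  by apply: memv_suml => v _; rewrite linearZ /= memvZ.
have [e0|] := pickP (fun _ : bedge H => true); last first.
  by move=> noE; rewrite big_pred0 ?mem0v.
(* Since [g] has total 0, subtracting the path flow of the fixed edge [e0] from every term leaves
   the sum unchanged. *)
move=> _; have -> : \sum_e par_flow (g (inl e) *: par_delta (inl e)) =
  \sum_e g (inl e) *: (par_flow (par_delta (inl e)) - par_flow (par_delta (inl e0))).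
  rewrite [RHS](eq_bigr _ (fun e _ => scalerBr _ _ _)) big_split /= sumrN -scaler_suml.
  rewrite -[\sum_e g _]/(par_total g) g0 scale0r subr0.
  by apply: eq_bigr => e _; rewrite linearZ.
by apply: memv_suml => e _; apply: memvZ.
Qed.

(** As [par_flow] is injective, the direction has the dimension of the kernel of [par_total], a
    nonzero linear form on a space of dimension [#|bedge H| + #|H|]. *)
Lemma flow_dim : (0 < #|H|)%N ->
  has_dim (flow_polytope1 R (extension H)) (#|bedge H| + #|H|).-1.
Proof.
move=> /card_gt0P [v0 _]; have [e0 _] := has_binc v0.
split; first by exists (par_flow (par_delta (inl e0))); apply: edge_flow.
exists (linfun par_flow @: lker (linfun par_total))%VS; first exact: flow_direction.
rewrite limg_dim_eq; last first.
  apply/eqP; rewrite -subv0; apply/subvP => g /memv_capP [_].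
  by rewrite memv_ker lfunE /= memv0 -(linear0 par_flow) => /eqP /par_flow_inj ->.
have := limg_ker_dim (linfun par_total) fullv; rewrite capfv dimvf.
have -> : dim Par = (#|bedge H| + #|H|)%N by rewrite /dim /= card_sum muln1.
move=> <-; suff -> : \dim (limg (linfun par_total)) = 1%N by rewrite addn1.
apply/eqP; rewrite eqn_leq; apply/andP; split.
  by apply: leq_trans (dimvS (subvf _)) _; rewrite dimvf.
rewrite lt0n dimv_eq0; apply/eqP => h.
have := memv_img (linfun par_total) (memvf (par_delta (inl e0))).
by rewrite h memv0 lfunE /= par_total_edge oner_eq0.
Qed.

(** * Lattice points of the dilates *)

Lemma dilate_flow (t : nat) f : (0 < #|H|)%N ->
  (exists2 p, flow_polytope1 R (extension H) p & f = t%:R *: p) <-> flow_of t%:R f.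
Proof.
move=> /card_gt0P [v0 _]; have [e0 _] := has_binc v0.
split=> [[p /flow_polytope1E pP ->]|fP].
  by rewrite -[X in flow_of X]mulr1; apply: flow_ofZ.
case: t fP => [|t] fP; last first.
  exists (t.+1%:R^-1 *: f); last by rewrite scalerA divff ?scale1r ?pnatr_eq0.
  apply/flow_polytope1E; have := @flow_ofZ t.+1%:R t.+1%:R^-1 f.
  by rewrite mulVf ?pnatr_eq0 //; apply; rewrite ?invr_ge0 ?ler0n.
(* For [t = 0] any point of the polytope serves: a flow of value 0 vanishes, its coordinates being
   nonnegative and at most 0. *)
exists (par_flow (par_delta (inl e0))); first exact: edge_flow.
rewrite scale0r; apply/ffunP => x; rewrite ffunE; apply/eqP; rewrite eq_le.
by rewrite (flow_of_le _ fP); case: fP => -> _ _.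
Qed.

Definition point_par N (j : {ffun bedge H -> 'I_N} * {ffun H -> 'I_N}) : Par :=
  [ffun k => match k with inl e => (j.1 e)%:R | inr v => (j.2 v)%:R end].

Lemma point_par_inj N : injective (@point_par N).
Proof.
move=> [f a] [f' a'] /ffunP h; congr pair; apply/ffunP => x; apply/val_inj/eqP.
  by have /eqP := h (inl x); rewrite !ffunE eqr_nat.
by have /eqP := h (inr x); rewrite !ffunE eqr_nat.
Qed.

Lemma par_weight_point N (j : {ffun bedge H -> 'I_N} * {ffun H -> 'I_N}) v :
  par_weight (point_par j) v = (weight (@binc H) j.1 v)%:R.
Proof. by rewrite natr_sum; apply: eq_bigr => e _; rewrite ffunE. Qed.

(** The coordinates of an integer flow are naturals at most [t < N], so truncation to ['I_N]
    recovers them. Conversely the bound by the weight makes the copy [false] nonnegative, and it is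
    integral as a difference of integers. *)
Lemma dilate_lattice_points N t : (0 < #|H|)%N -> (t < N)%N ->
  dilate_lattice (flow_polytope1 R (extension H)) t =
  [set par_flow (point_par j) | j in [set` weighted_points (@binc H) N t]]%classic.
Proof.
move=> H0 lttN; apply/seteqP; split=> [f [/(dilate_flow _ _ H0) fP fint]|].
  have fle x : (Num.truncn (f x : R) < N)%N.
    rewrite (leq_ltn_trans _ lttN) // -(natrK (R := R) t); apply: le_truncn.
    exact: flow_of_le fP.
  case: (fP) => f0 bal ft.
  have fK x : (Num.truncn (f x : R))%:R = f x :> R.
    by apply: truncnK; rewrite natrEint fint f0.
  pose a : {ffun bedge H -> 'I_N} := [ffun e => Ordinal (fle (inl e))].
  pose b : {ffun H -> 'I_N} := [ffun v => Ordinal (fle (pend v true))].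
  have parE : point_par (a, b) = flow_par f.
    by apply/ffunP => -[e|v]; rewrite !ffunE /= fK.
  exists (a, b); last by rewrite parE flow_parK.
  rewrite /= inE; apply/andP; split=> /=.
    rewrite -(eqr_nat R) natr_sum -ft; apply/eqP/eq_bigr => e _.
    by rewrite ffunE /= fK.
  apply/familyP => v; rewrite inE /= -(ler_nat R) -(par_weight_point (a, b)) parE.
  rewrite ffunE /= fK; have -> : par_weight (flow_par f) v = f (pend v true) + f (pend v false).
    by rewrite bal; apply: eq_bigr => e _; rewrite ffunE.
  by rewrite lerDl.
move=> _ [j /= + <-]; rewrite inE => /andP [/eqP jt /familyP jw].
have tE : par_total (point_par j) = t%:R.
  by rewrite -jt natr_sum; apply: eq_bigr => e _; rewrite ffunE.
split.
  apply/(dilate_flow _ _ H0); rewrite -tE; apply: par_flow_of => [e|v].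
    by rewrite ffunE ler0n.
  by rewrite ffunE ler0n par_weight_point ler_nat; have := jw v; rewrite inE.
move=> x; case: (ext_edgeP x) => [e|v b]; first by rewrite par_flow_inner ffunE /= intr_nat.
by rewrite par_flow_pend par_weight_point ffunE; case: b; rewrite ?rpredB ?intr_nat.
Qed.

Lemma card_dilate_lattice N t : (0 < #|H|)%N -> (t < N)%N ->
  (dilate_lattice (flow_polytope1 R (extension H)) t
   #= `I_(weighted_count (@binc H) N t))%card.
Proof.
move=> H0 lttN; rewrite (dilate_lattice_points H0 lttN) -card_weighted_points //.
set A := weighted_points _ _ _.
have -> : [set` A]%classic = [set enum_val i | i in [set: 'I_#|A|]]%classic.
  apply/seteqP; split=> [j /= jA|_ [i _ <-] /=]; last exact: enum_valP.
  by exists (enum_rank_in jA j) => //; rewrite enum_rankK_in.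
rewrite image_comp; apply: card_eq_trans (_ : _ #= [set: 'I_#|A|])%card _.
  apply: inj_card_eq => i i' _ _ /par_flow_inj /point_par_inj; exact: enum_val_inj.
by rewrite card_eq_sym card_II.
Qed.

End Flow.

(** * Identification of the two polynomials *)

Theorem theorem1p8 (R : realType) (H : bigraph) (Hconn : sconnected H)
    (Hdeg : forall v : H, (1 < sdeg v)%N) :
  matching_poly (whisker H) = hstar (flow_polytope1 R (extension H)).
Proof.
have [H0 _] := Hconn.
have deg_gt0 (v : H) : (0 < #|[pred e | binc e v]|)%N by rewrite binc_degree ltnW.
rewrite matching_poly_whisker; apply/esym/hstarE.
exists (#|bedge H| + #|H|).-1, (fun t => weighted_count (@binc H) t.+1 t); split.
- exact: flow_dim.
- by move=> t; apply: card_dilate_lattice.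
(* The exponent [d.+1] becomes [#|bedge H| + #|H|], and the coefficient of degree [n] is then read
   modulo ['X^n.+1]. *)
move=> n; rewrite prednK; last by rewrite addn_gt0 H0 orbT.
rewrite -(weight_gf_cover_poly (@binc_card H) deg_gt0 (ltnSn n)) coefM.
apply: eq_bigr => i _; congr (_ * _); rewrite coef_weight_gf; congr _%:R.
(* The counts with bounds [(n - i).+1] and [n.+1] agree because both count the lattice points of the
   same dilate. *)
apply/card_eq_II; apply: card_eq_trans (card_dilate_lattice R deg_gt0 H0 _).
  by rewrite card_eq_sym; apply: card_dilate_lattice.
by rewrite ltnS leq_subr.
Qed.
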